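(* Consider the constrained joint dynamics $$\frac{dy}{dt}=-\alpha\,P_{\mathcal{Q}}\bigl(\delta^T\delta\,x\bigr),\qquad \frac{d\delta}{dt}=-\beta\,\Pi_{\mathcal{M}}\bigl(\delta\,x\,x^T\bigr),\qquad x=\tilde u+\tilde y,\quad \alpha,\beta>0,$$ and a solution with precompact forward orbit. Let $v$ be an interior free vertex all of whose incidences adapt: all edges incident to $v$ lie in $E_{FF}$ and $(v,e)\in\mathcal{I}$ for every edge $e$ incident to $v$. Then $$Q_{vv}(t)=\alpha\,(L_{\mathcal{F}}(t))_{vv}-\beta\,x_v(t)x_v(t)^T\in\mathrm{Hom}(\mathcal{F}(v),\mathcal{F}(v))$$ is constant in time. Moreover, if $Q_{vv}(0)$ has a negative eigenvalue then $x_v(t)\not\to0$ as $t\to\infty$, and if $Q_{vv}(0)$ has a positive eigenvalue then the restriction maps incident to $v$ cannot all vanish (i.e. it is not the case that they all tend to $0$ as $t\to\infty$).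
   Context: Let $G=(V,E)$ be a finite connected graph. A discourse sheaf $\mathcal{F}$ on $G$ assigns finite-dimensional real inner product spaces $\mathcal{F}(v)$, $\mathcal{F}(e)$ to vertices and edges and linear restriction maps $\mathcal{F}_{v\unlhd e}:\mathcal{F}(v)\to\mathcal{F}(e)$ to incidences $v\in e$ (written $v\unlhd e$). $C^0=\bigoplus_v\mathcal{F}(v)$, $C^1=\bigoplus_e\mathcal{F}(e)$ with direct-sum inner products. For a fixed edge orientation the coboundary is $(\delta x)_e=\mathcal{F}_{v\unlhd e}(x_v)-\mathcal{F}_{u\unlhd e}(x_u)$ for $e=u\to v$. In the joint dynamics the stalks are fixed, but the restriction maps, encoded by the blocks of $\delta$ (the block from $\mathcal{F}(v)$ to $\mathcal{F}(e)$ is $\pm\mathcal{F}_{v\unlhd e}$, and blocks for non-incident pairs are zero), vary with time. $L_{\mathcal{F}}(t)=\delta(t)^T\delta(t)$ and $(L_{\mathcal{F}}(t))_{vv}=\sum_{e\ni v}\mathcal{F}_{v\unlhd e}(t)^T\mathcal{F}_{v\unlhd e}(t)$ is its diagonal block at $v$. Stubborn opinions: $U\subseteq V$ is the set of stubborn vertices, $F=V\setminus U$ the set of free vertices; each stalk splits orthogonally as $\mathcal{F}(v)=S_v\oplus T_v$ with $T_v=S_v^\perp$ and $S_v=\{0\}$ for $v\notin U$. $C^0(S)=\bigoplus_vS_v$, $C^0(\mathcal{Q})=\bigoplus_vT_v$; $P_{\mathcal{Q}}:C^0\to C^0(\mathcal{Q})$ is the orthogonal projection. $u\in C^0(S)$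 is fixed (constant in time), $y(t)\in C^0(\mathcal{Q})$ evolves, and $\tilde u,\tilde y$ denote their inclusions in $C^0$. $E_{FF}$ is the set of edges with both endpoints in $F$. Adapting incidences: $\mathcal{I}\subseteq\{(v,e):v\unlhd e\}$. $\mathcal{M}$ is the space of structure velocities leaving non-adapting maps unchanged, i.e. linear maps $C^0\to C^1$ whose block from $\mathcal{F}(v)$ to $\mathcal{F}(e)$ vanishes unless $(v,e)\in\mathcal{I}$; $\Pi_{\mathcal{M}}$ is the orthogonal projection onto $\mathcal{M}$ in the Frobenius inner product. $\delta xx^T$ denotes the map $z\mapsto\langle x,z\rangle\,\delta x$. The forward orbit is $\{(y(t),\delta(t)):t\ge0\}$. The restriction maps incident to $v$ are the $\mathcal{F}_{v\unlhd e}$, $e\ni v$. *)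

(* Defs.v *)
From HB Require Import structures.
From mathcomp Require Import all_boot all_order all_algebra.
From mathcomp Require Import all_classical all_reals all_analysis.

Set Implicit Arguments.
Unset Strict Implicit.
Unset Printing Implicit Defensive.

Import Order.TTheory GRing.Theory Num.Theory.

Import passmx.

Local Open Scope ring_scope.

(* Finite-dimensional real inner product spaces are pairs of a [vectType] [V]
   and a [{dot V for idfun}]; the library only provides sums of copies of a
   single [vectType], hence the construction for families below. *)
Definition dsum (R : fieldType) (I : finType) (E : I -> vectType R) : Type :=
  {dffun forall i, E i}.

Section DsumVect.
Variables (R : fieldType) (I : finType) (E : I -> vectType R).
Local Notation D := (dsum E).

HB.instance Definition _ := Choice.on D.

Definition dsum_of (f : forall i, E i) : D := [ffun i => f i].

Lemma dsum_ofE f i : dsum_of f i = f i.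
Proof. by exact: ffunE. Qed.

Lemma dsumP (x y : D) : (forall i, x i = y i) <-> x = y.
Proof. by split=> [h|-> //]; apply/ffunP => i; exact: h. Qed.

Definition dsum_add (x y : D) := dsum_of (fun i => x i + y i).
Definition dsum_opp (x : D) := dsum_of (fun i => - x i).
Definition dsum_scale (a : R) (x : D) := dsum_of (fun i => a *: x i).

Fact dsum_addA : associative dsum_add.
Proof. by move=> x y z; apply/dsumP => i; rewrite !dsum_ofE addrA. Qed.
Fact dsum_addC : commutative dsum_add.
Proof. by move=> x y; apply/dsumP => i; rewrite !dsum_ofE addrC. Qed.
Fact dsum_add0 : left_id (dsum_of (fun=> 0)) dsum_add.
Proof. by move=> x; apply/dsumP => i; rewrite !dsum_ofE add0r. Qed.
Fact dsum_addN : left_inverse (dsum_of (fun=> 0)) dsum_opp dsum_add.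
Proof. by move=> x; apply/dsumP => i; rewrite !dsum_ofE addNr. Qed.
HB.instance Definition _ :=
  GRing.isZmodule.Build D dsum_addA dsum_addC dsum_add0 dsum_addN.

Fact dsum_scaleA a b x : dsum_scale a (dsum_scale b x) = dsum_scale (a * b) x.
Proof. by apply/dsumP => i; rewrite !dsum_ofE scalerA. Qed.
Fact dsum_scale1 : left_id 1 dsum_scale.
Proof. by move=> x; apply/dsumP => i; rewrite !dsum_ofE scale1r. Qed.
Fact dsum_scaleDr : right_distributive dsum_scale +%R.
Proof. by move=> a x y; apply/dsumP => i; rewrite !dsum_ofE scalerDr. Qed.
Fact dsum_scaleDl x : {morph dsum_scale^~ x : a b / a + b}.
Proof. by move=> a b; apply/dsumP => i; rewrite !dsum_ofE scalerDl. Qed.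
HB.instance Definition _ := GRing.Zmodule_isLmodule.Build R D
  dsum_scaleA dsum_scale1 dsum_scaleDr dsum_scaleDl.

Lemma dsumDE (x y : D) i : (x + y) i = x i + y i.
Proof. exact: dsum_ofE. Qed.
Lemma dsumZE a (x : D) i : (a *: x) i = a *: x i.
Proof. exact: dsum_ofE. Qed.
Lemma dsum0E i : (0 : D) i = 0.
Proof. exact: dsum_ofE. Qed.

Fact dsum_vect_axiom :
  Vector.axiom #|{: {i : I & 'I_(\dim {:E i})}}| D.
Proof.
pose T := {i : I & 'I_(\dim {:E i})}.
pose b i := vbasis {:E i}.
pose to (x : D) : 'rV[R]_#|{: T}| :=
  \row_k coord (b (tag (enum_val k))) (tagged (enum_val k))
    (x (tag (enum_val k))).
pose fro (r : 'rV[R]_#|{: T}|) : D :=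
  dsum_of (fun i => \sum_(j < \dim {:E i}) r 0 (enum_rank (existT _ i j : T)) *: (b i)`_j).
exists to.
  move=> a x y; apply/rowP => k; rewrite !mxE -linearP; congr (coord _ _ _).
  by apply: etrans (dsumDE _ _ _) _; congr (_ + _); apply: dsumZE.
exists fro => [x|r].
  apply/dsumP => i; rewrite dsum_ofE.
  rewrite [RHS](coord_vbasis (memvf _)); apply: eq_bigr => j _.
  by rewrite !mxE enum_rankK.
apply/rowP => k; rewrite !mxE dsum_ofE.
rewrite coord_sum_free ?(basis_free (vbasisP _)) //.
by congr (r 0 _); rewrite -[RHS]enum_valK; congr enum_rank; case: (enum_val k).
Qed.
HB.instance Definition _ := Lmodule_hasFinDim.Build R D dsum_vect_axiom.

Definition dproj_fun i (x : D) : E i := x i.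

Fact dproj_linear i : linear (@dproj_fun i).
Proof. by move=> a x y; rewrite /dproj_fun dsumDE dsumZE. Qed.
HB.instance Definition _ i :=
  GRing.isLinear.Build R D (E i) _ (@dproj_fun i) (@dproj_linear i).

Definition dproj i : 'Hom(D, E i) := linfun (@dproj_fun i).

Lemma dprojE i (x : D) : dproj i x = x i.
Proof. by rewrite lfunE. Qed.


Definition dinj_fun i (z : E i) : D :=
  dsum_of (eqtype.dfwith (fun j => 0 : E j) z).

Fact dinj_linear i : linear (@dinj_fun i).
Proof.
move=> a x y; apply/dsumP => j; rewrite dsumDE dsumZE !dsum_ofE.
have [ij|ij] := eqVneq i j; first by case: _ / ij; rewrite !eqtype.dfwith_in.
by rewrite !eqtype.dfwith_out // scaler0 addr0.
Qed.
HB.instance Definition _ i :=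
  GRing.isLinear.Build R (E i) D _ (@dinj_fun i) (@dinj_linear i).

Definition dinj i : 'Hom(E i, D) := linfun (@dinj_fun i).

Lemma dinj_in i (z : E i) : dinj i z i = z.
Proof. by rewrite lfunE /= dsum_ofE eqtype.dfwith_in. Qed.
Lemma dinj_out i j (z : E i) : i != j -> dinj i z j = 0.
Proof. by move=> ij; rewrite lfunE /= dsum_ofE eqtype.dfwith_out. Qed.

Lemma dsum_sumE (J : Type) (r : seq J) (P : pred J) (F : J -> D) i :
  (\sum_(j <- r | P j) F j) i = \sum_(j <- r | P j) F j i.
Proof.
by elim/big_rec2: _ => [|j y x _ <-]; rewrite ?dsum0E ?dsumDE.
Qed.

Lemma dsum_decomp (x : D) : x = \sum_i dinj i (x i).
Proof.
apply/dsumP => j; rewrite dsum_sumE (bigD1 j) //= dinj_in.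
by rewrite big1 ?addr0 // => i ij; rewrite dinj_out.
Qed.

End DsumVect.

Section OrthonormalBasis.
Variables (R : rcfType) (V : vectType R) (dot : {dot V for idfun}).
Local Notation "''[' x , y ]" := (dot x y).

Lemma dotC x y : '[x, y] = '[y, x].
Proof. by rewrite hermC expr0 mul1r. Qed.

Lemma dot_gt0 x : x != 0 -> 0 < '[x, x].
Proof. exact: neq0_dnorm_gt0. Qed.

Lemma dot_ge0 x : 0 <= '[x, x].
Proof. by have [->|/dot_gt0/ltW //] := eqVneq x 0; rewrite linear0r. Qed.

Lemma dot_eq0 x : ('[x, x] == 0) = (x == 0).
Proof.
by have [->|/dot_gt0/lt0r_neq0/negPf //] := eqVneq x 0; rewrite linear0r eqxx.
Qed.

Lemma dot_inj x y : (forall z, '[z, x] = '[z, y]) -> x = y.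
Proof.
move=> h; apply/eqP; rewrite -subr_eq0 -dot_eq0.
by rewrite linearBr /= h subrr.
Qed.

Lemma dotZl a x y : '[a *: x, y] = a * '[x, y].
Proof. exact: linearZl_LR. Qed.
Lemma dotZr a x y : '[x, a *: y] = a * '[x, y].
Proof. exact: linearZr_LR. Qed.
Lemma dotDl x y z : '[x + y, z] = '[x, z] + '[y, z].
Proof. exact: linearDl. Qed.
Lemma dotDr x y z : '[x, y + z] = '[x, y] + '[x, z].
Proof. exact: linearDr. Qed.
Lemma dotBl x y z : '[x - y, z] = '[x, z] - '[y, z].
Proof. exact: linearBl. Qed.
Lemma dot_suml (J : Type) (r : seq J) (P : pred J) (F : J -> V) z :
  '[\sum_(j <- r | P j) F j, z] = \sum_(j <- r | P j) '[F j, z].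
Proof.
elim/big_rec2: _ => [|j y x _ <-]; first exact: linear0l.
by rewrite dotDl.
Qed.
Lemma dot_sumr (J : Type) (r : seq J) (P : pred J) (F : J -> V) z :
  '[z, \sum_(j <- r | P j) F j] = \sum_(j <- r | P j) '[z, F j].
Proof. by rewrite dotC dot_suml; apply: eq_bigr => j _; rewrite dotC. Qed.

Lemma onb_sub (W : {vspace V}) : exists s, [/\ uniq s, {subset s <= W},
    {in s &, forall x y, '[x, y] = (x == y)%:R}
  & {in W, forall x, x = \sum_(e <- s) '[x, e] *: e}].
Proof.
suff [s [us sW os]] : exists s, [/\ free s, {subset s <= W},
      {in s &, forall x y, '[x, y] = (x == y)%:R}
    & {subset W <= span s} \/ size s = (\dim {:V}).+1].
  case=> [sp|sz]; last first.
    by have := dimvS (subvf (span s)); rewrite (eqP us) sz ltnn.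
  exists s; split=> //; first exact: free_uniq.
  move=> x /sp xs; have [k -> _] := free_span us xs.
  apply: eq_big_seq => e es; congr (_ *: _).
  rewrite dot_suml /= (bigD1_seq e) ?free_uniq //=.
  rewrite dotZl os // eqxx mulr1 big_seq_cond big1 ?addr0 //.
  by move=> f /andP[fs /negPf fe]; rewrite dotZl os // fe mulr0.
elim: (_.+1) => [|n [s [us sW os]]].
  by exists [::]; split=> //; [rewrite nil_free | right].
case=> [sp|sz]; first by exists s; split=> //; left.
have [sp|] := boolP (W <= span s)%VS.
  by exists s; split=> //; left; exact/subvP.
case/subvPn => v vW vs.
pose w := v - \sum_(e <- s) '[v, e] *: e.
have ws : w \notin span s.
  rewrite rpredBr //; rewrite big_seq.
  by apply: rpred_sum => e es; rewrite rpredZ ?memv_span.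
have wW : w \in W.
  rewrite rpredB // big_seq.
  by apply: rpred_sum => e es; rewrite rpredZ ?sW.
have wo e : e \in s -> '[w, e] = 0.
  move=> es; rewrite /w dotBl dot_suml /=.
  rewrite (bigD1_seq e) ?free_uniq //= dotZl os // eqxx mulr1.
  rewrite big_seq_cond big1 ?addr0 ?subrr // => f /andP[fs /negPf fe].
  by rewrite dotZl os // fe mulr0.
have w0 : w != 0 by apply: contraNneq ws => ->; rewrite mem0v.
pose c := Num.sqrt '[w, w].
have c0 : c != 0 by rewrite sqrtr_eq0 -ltNge dot_gt0.
have cs : c^-1 *: w \notin span s.
  by apply: contra ws => /(memvZ c); rewrite scalerA mulfV // scale1r.
exists (c^-1 *: w :: s); split; first by rewrite free_cons cs.
- by move=> x; rewrite inE => /predU1P[->|/sW //]; rewrite rpredZ.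
- have ns e : e \in s -> (c^-1 *: w == e) = false.
    by move=> es; apply: contraNF cs => /eqP ->; rewrite memv_span.
  move=> x y; rewrite !inE => /predU1P[->|xs] /predU1P[->|ys]; last exact: os.
  + rewrite eqxx dotZl dotZr -(sqr_sqrtr (dot_ge0 w)) -/c expr2.
    by rewrite mulKf // mulVf.
  + by rewrite ns // dotZl wo // mulr0.
  + by rewrite eq_sym ns // dotC dotZl wo // mulr0.
by right; rewrite /= sz.
Qed.

Definition is_onb (s : seq V) :=
  [/\ uniq s, {in s &, forall x y, '[x, y] = (x == y)%:R}
    & forall x, x = \sum_(e <- s) '[x, e] *: e].

Lemma onb_exists : exists s, is_onb s.
Proof.
by have [s [us _ os sp]] := onb_sub fullv; exists s; split=> // x; rewrite -sp ?memvf.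
Qed.

End OrthonormalBasis.

Section Adjoint.
Variables (R : rcfType) (V W : vectType R).
Variables (dV : {dot V for idfun}) (dW : {dot W for idfun}).

(* The transpose with respect to the two inner products; it exists and is
   unique by [adjointP] and [adjoint_unique]. *)
Definition adjoint (f : 'Hom(V, W)) : 'Hom(W, V) :=
  xget 0 [set g : 'Hom(W, V) | forall x y, dV (g y) x = dW y (f x)].

Lemma adjointP f x y : dV (adjoint f y) x = dW y (f x).
Proof.
rewrite /adjoint; case: xgetP => [g -> //|].
have [s [us os sp]] := onb_exists dV.
pose h y := \sum_(e <- s) dW y (f e) *: e.
have hl : linear h.
  move=> a z t; rewrite scaler_sumr -big_split; apply: eq_bigr => e _ /=.
  by rewrite dotDl dotZl scalerDl scalerA.
pose hM := GRing.isLinear.Build R W V _ h hl.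
pose hL : {linear W -> V} := HB.pack h hM.
move=> /(_ (linfun hL)) []; move=> {}x {}y; rewrite lfunE /= /h.
rewrite [in RHS](sp x) linear_sum dot_suml dot_sumr.
apply: eq_bigr => e _; rewrite dotZl linearZ dotZr.
by rewrite mulrC dotC.
Qed.

Lemma adjointPr f x y : dV x (adjoint f y) = dW (f x) y.
Proof. by rewrite dotC adjointP dotC. Qed.

Lemma adjoint_unique (f : 'Hom(V, W)) (g : 'Hom(W, V)) :
  (forall x y, dV (g y) x = dW y (f x)) -> g = adjoint f.
Proof.
move=> h; apply/lfunP => y; apply: (@dot_inj _ _ dV) => z.
by rewrite dotC h adjointPr dotC.
Qed.

(* [w x^T], i.e. [z |-> <x, z> w]. *)
Definition rank1_fun (w : W) (x : V) (z : V) : W := dV x z *: w.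
Fact rank1_linear w x : linear (rank1_fun w x).
Proof. by move=> a y z; rewrite /rank1_fun dotDr dotZr scalerDl scalerA. Qed.
HB.instance Definition _ w x :=
  GRing.isLinear.Build R V W _ (rank1_fun w x) (rank1_linear w x).
Definition rank1 w x : 'Hom(V, W) := linfun (rank1_fun w x).

Lemma rank1E w x z : rank1 w x z = dV x z *: w.
Proof. by rewrite lfunE. Qed.

Definition lftrace (f : 'End(V)) : R :=
  \tr (mxof (vbasis {:V}) (vbasis {:V}) f).

Lemma lftrace_onb s f : is_onb dV s -> lftrace f = \sum_(e <- s) dV (f e) e.
Proof.
case=> us os sp; rewrite /lftrace /mxtrace.
transitivity (\sum_(i < \dim {:V}) \sum_(e <- s)
    dV (f (vbasis {:V})`_i) e * coord (vbasis {:V}) i e).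
  apply: eq_bigr => i _; rewrite !mxE /= vecof_delta /=.
  rewrite [in LHS](sp (f _)) linear_sum; apply: eq_bigr => e _.
  by rewrite linearZ.
rewrite exchange_big; apply: eq_bigr => e _ /=.
have -> : f e = \sum_i coord (vbasis {:V}) i e *: f (vbasis {:V})`_i.
  rewrite {1}(coord_vbasis (memvf e)) linear_sum.
  by apply: eq_bigr => i _; rewrite linearZ.
by rewrite dot_suml; apply: eq_bigr => i _; rewrite dotZl mulrC.
Qed.
End Adjoint.

Section Frobenius.
Variables (R : rcfType) (V W : vectType R).
Variables (dV : {dot V for idfun}) (dW : {dot W for idfun}).

(* [tr (f^T g)]. *)
Definition frob (f g : 'Hom(V, W)) : R := lftrace (adjoint dV dW f \o g)%VF.

Lemma frob_onb s f g : is_onb dV s -> frob f g = \sum_(e <- s) dW (f e) (g e).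
Proof.
move=> os; rewrite /frob (lftrace_onb _ os); apply: eq_bigr => e _.
by rewrite comp_lfunE /= adjointP dotC.
Qed.

Fact frob_sym f g : frob f g = (-1) ^+ false * idfun (frob g f).
Proof.
have [s os] := onb_exists dV; rewrite expr0 mul1r /= !(frob_onb _ _ os).
by apply: eq_bigr => e _; rewrite dotC.
Qed.

Fact frob_bilinear : bilinear_for *%R *%R (frob : _ -> _ -> R).
Proof.
have [s os] := onb_exists dV.
by split=> [h a f g|h a f g]; rewrite /= !(frob_onb _ _ os) mulr_sumr -big_split;
  apply: eq_bigr => e _; rewrite add_lfunE scale_lfunE
    ?(dotDl, dotZl, dotDr, dotZr).
Qed.

Fact frob_gt0 f : f != 0 -> 0 < frob f f.
Proof.
have [s os] := onb_exists dV; have [us oo sp] := os.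
rewrite (frob_onb _ _ os) => f0.
have ge0 : forall e, e \in s -> true -> 0 <= dW (f e) (f e).
  by move=> e _ _; exact: dot_ge0.
rewrite lt_def sumr_ge0 ?andbT; last by move=> e _; exact: dot_ge0.
apply: contra f0; rewrite big_seq psumr_eq0; last by move=> e es; exact: ge0.
move=> /allP h; apply/eqP/lfunP => x; rewrite (sp x) linear_sum zero_lfunE.
rewrite big_seq big1 // => e es; rewrite linearZ /=.
have := h _ es; rewrite es /= dot_eq0 => /eqP ->.
by rewrite scaler0.
Qed.

HB.instance Definition _ := bilinear_isBilinear.Build R 'Hom(V, W) 'Hom(V, W) R
  *%R *%R frob frob_bilinear.
HB.instance Definition _ :=
  isHermitianSesquilinear.Build R 'Hom(V, W) false idfun frob frob_sym.
HB.instance Definition _ := isDotProduct.Build R 'Hom(V, W) frob frob_gt0.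

End Frobenius.

Section DsumDot.
Variables (R : rcfType) (I : finType) (E : I -> vectType R).
Variable (dE : forall i, {dot E i for idfun}).

Definition dsum_dot (x y : dsum E) : R := \sum_i dE i (x i) (y i).

Fact dsum_dot_sym x y : dsum_dot x y = (-1) ^+ false * idfun (dsum_dot y x).
Proof.
by rewrite expr0 mul1r; apply: eq_bigr => i _; rewrite dotC.
Qed.

Fact dsum_dot_bilinear : bilinear_for *%R *%R (dsum_dot : _ -> _ -> R).
Proof.
by split=> [z a x y|z a x y]; rewrite /= /dsum_dot mulr_sumr -big_split;
  apply: eq_bigr => i _; rewrite dsumDE dsumZE ?(dotDl, dotZl, dotDr, dotZr).
Qed.

Fact dsum_dot_gt0 x : x != 0 -> 0 < dsum_dot x x.
Proof.
move=> x0; rewrite lt_def sumr_ge0 ?andbT; last by move=> i _; exact: dot_ge0.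
apply: contra x0; rewrite psumr_eq0; last by move=> i _; exact: dot_ge0.
move=> /allP h; apply/eqP/dsumP => i; rewrite dsum0E; apply/eqP.
by rewrite -(dot_eq0 (dE i)); apply: h; rewrite mem_index_enum.
Qed.

HB.instance Definition _ := bilinear_isBilinear.Build R (dsum E) (dsum E) R
  *%R *%R dsum_dot dsum_dot_bilinear.
HB.instance Definition _ :=
  isHermitianSesquilinear.Build R (dsum E) false idfun dsum_dot dsum_dot_sym.
HB.instance Definition _ := isDotProduct.Build R (dsum E) dsum_dot dsum_dot_gt0.

End DsumDot.

Section OrthProj.
Variables (R : rcfType) (V : vectType R) (dot : {dot V for idfun}).

Definition orthproj (W : {vspace V}) : 'End(V) := daddv_pi W (orthov dot W).

Lemma orthprojP W x :
  orthproj W x \in W /\ forall w, w \in W -> dot (x - orthproj W x) w = 0.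
Proof.
have WO : (W :&: orthov dot W = 0)%VS.
  apply/eqP; rewrite -subv0; apply/subvP => w; rewrite memv_cap memv0.
  by case/andP=> wW /mem_orthovP/(_ w wW)/eqP; rewrite dot_eq0.
have WOx : x \in (W + orthov dot W)%VS.
  have [s [us sW os sp]] := onb_sub dot W.
  pose p := \sum_(e <- s) dot x e *: e.
  rewrite -(subrK p x) addrC memv_add //.
    by rewrite /p big_seq rpred_sum // => e es; rewrite rpredZ ?sW.
  apply/mem_orthovP => w wW; suff: dot (x - p) w = 0 by [].
  rewrite (sp w wW) dot_sumr big_seq big1 // => e es.
  rewrite dotZr dotBl dot_suml (bigD1_seq e) //= dotZl os // eqxx mulr1.
  rewrite big_seq_cond big1 ?addr0 ?subrr ?mulr0 // => f /andP[fs /negPf fe].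
  by rewrite dotZl os // fe mulr0.
split; first exact: memv_pi.
move=> w wW; rewrite -{1}(daddv_pi_add WO WOx) addrC addKr.
by apply: mem_orthovP wW; exact: memv_pi.
Qed.
End OrthProj.

Section Blocks.
Variables (R : rcfType) (I J : finType).
Variables (E : I -> vectType R) (F : J -> vectType R).

Definition block i j (f : 'Hom(dsum E, dsum F)) : 'Hom(E i, F j) :=
  (dproj F j \o f \o dinj E i)%VF.

Fact block_linear i j : linear (block i j).
Proof.
by move=> a f g; apply/lfunP => z; rewrite !(comp_lfunE, add_lfunE, scale_lfunE)
  !dprojE dsumDE dsumZE.
Qed.
HB.instance Definition _ i j :=
  GRing.isLinear.Build R 'Hom(dsum E, dsum F) 'Hom(E i, F j) _
    (block i j) (@block_linear i j).

Lemma blockE i j (f : 'Hom(dsum E, dsum F)) z : block i j f z = f (dinj E i z) j.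
Proof. by rewrite !comp_lfunE dprojE. Qed.

Lemma block_sumE (f : 'Hom(dsum E, dsum F)) x j : f x j = \sum_i block i j f (x i).
Proof.
rewrite {1}[x]dsum_decomp linear_sum dsum_sumE.
by apply: eq_bigr => i _; rewrite blockE.
Qed.

(* The maps whose [(i, j)] block vanishes unless [(i, j) \in A]. *)
Definition supported_maps (A : {set I * J}) : {vspace 'Hom(dsum E, dsum F)} :=
  (\bigcap_(p | p \notin A) lker (linfun (block p.1 p.2)))%VS.

Lemma supported_mapsP (A : {set I * J}) f :
  reflect (forall i j, (i, j) \notin A -> block i j f = 0)
          (f \in supported_maps A).
Proof.
rewrite /supported_maps memvE.
apply: (iffP subv_bigcapP) => h.
  by move=> i j /h; rewrite -memvE memv_ker lfunE /= => /eqP.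
by move=> [i j] /h /eqP; rewrite -memvE memv_ker lfunE.
Qed.

Definition dsum_sub (S : forall i, {vspace E i}) : {vspace dsum E} :=
  (\bigcap_i (dproj E i @^-1: S i))%VS.

Lemma dsum_subP (S : forall i, {vspace E i}) (x : dsum E) :
  reflect (forall i, x i \in S i) (x \in dsum_sub S).
Proof.
rewrite /dsum_sub memvE; apply: (iffP subv_bigcapP) => h i.
  by have := h i isT; rewrite -memvE -memv_preim dprojE.
by move=> _; rewrite -memvE -memv_preim dprojE; exact: h.
Qed.

End Blocks.

Lemma block_adjoint (R : rcfType) (I J : finType)
    (E : I -> vectType R) (F : J -> vectType R)
    (dE : forall i, {dot E i for idfun}) (dF : forall j, {dot F j for idfun})
    i j (f : 'Hom(dsum E, dsum F)) :
  block j i (adjoint (dsum_dot dE) (dsum_dot dF) f)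
  = adjoint (dE i) (dF j) (block i j f).
Proof.
apply: adjoint_unique => x y; rewrite !blockE.
have := adjointP (dsum_dot dE) (dsum_dot dF) f (dinj E i x) (dinj F j y).
rewrite /= /dsum_dot (bigD1 i) //= big1 ?addr0 => [|k ki]; last first.
  by rewrite dinj_out 1?eq_sym // linear0r.
rewrite (bigD1 j) //= big1 ?addr0 => [|k kj]; last first.
  by rewrite dinj_out 1?eq_sym // linear0l.
by rewrite !dinj_in.
Qed.

Section Sheaf.
Variables (R : rcfType) (V : finType).

(* An edge is the set of its two end points, so that [v \in val e] is
   incidence. *)
Definition edge (E : {set {set V}}) := {e : {set V} | e \in E}.

Variable E : {set {set V}}.

Definition simple_graph := forall e, e \in E -> #|e| = 2.
Definition connected_graph := forall v w, connect [rel a b | [set a; b]%SET \in E] v w.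

Variables (src tgt : edge E -> V).
Definition orientation := forall e : edge E, val e = [set src e; tgt e]%SET.

Variables (FV : V -> vectType R) (FE : edge E -> vectType R).
Local Notation Hom01 := ('Hom(dsum FV, dsum FE)).

(* The maps [dsum FV -> dsum FE] encoding restriction maps: the remaining blocks
   are, up to the orientation sign, the restriction maps; see [coboundaryE]. *)
Definition coboundary_like (d : Hom01) :=
  forall v (e : edge E), v \notin val e -> block v e d = 0.

Definition restriction (d : Hom01) v (e : edge E) : 'Hom(FV v, FE e) :=
  (if v == tgt e then 1 else -1) *: block v e d.

Lemma coboundaryE (d : Hom01) x (e : edge E) :
  simple_graph -> orientation -> coboundary_like d ->
  d x e = restriction d (tgt e) e (x (tgt e)) - restriction d (src e) e (x (src e)).
Proof.
move=> hE ho hd; have ste : src e != tgt e.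
  by have := hE _ (valP e); rewrite ho cards2; case: eqP.
rewrite block_sumE (bigD1 (tgt e)) //= (bigD1 (src e)) //= big1 ?addr0 => [|v].
  by rewrite /restriction eqxx (negPf ste) scale1r scaleN1r opp_lfunE opprK.
case/andP=> vt vs; rewrite hd ?zero_lfunE // ho !inE negb_or vs vt //.
Qed.

Variables (dV : forall v, {dot FV v for idfun}) (dE : forall e, {dot FE e for idfun}).

Definition laplacian (d : Hom01) : 'End(dsum FV) :=
  (adjoint (dsum_dot dV) (dsum_dot dE) d \o d)%VF.

Lemma laplacian_diagE (d : Hom01) v : coboundary_like d ->
  block v v (laplacian d) =
  \sum_(e : edge E | v \in val e)
    (adjoint (dV v) (dE e) (restriction d v e) \o restriction d v e)%VF.
Proof.
move=> hd; apply/lfunP => z; rewrite blockE comp_lfunE block_sumE sum_lfunE.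
rewrite [RHS]big_mkcond; apply: eq_bigr => e _ /=.
rewrite block_adjoint -blockE comp_lfunE.
case: ifPn => [_|/hd ->]; last by rewrite zero_lfunE linear0.
apply: (@dot_inj _ _ (dV v)) => t; rewrite !adjointPr /restriction.
by case: eqP; rewrite ?scale1r // scaleN1r !opp_lfunE linearNl linearNr opprK.
Qed.

End Sheaf.

(* A finite-dimensional real vector space has a unique Hausdorff vector topology.
   As [vectType] carries none, limits, derivatives and compactness in [W] are
   taken in ['rV[R]_n] through the coordinates in a basis; they do not depend on
   which basis is used. *)
Definition vcoord (R : rcfType) (W : vectType R) (x : W) : 'rV[R]_(\dim {:W}) :=
  rVof (vbasis {:W}) x.

(* Main.v *)
From HB Require Import structures.
Require Import Defs.
From mathcomp Require Import all_boot all_order all_algebra.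
From mathcomp Require Import all_classical all_reals all_analysis.
From mathcomp Require Import ring lra.

Set Implicit Arguments.
Unset Strict Implicit.
Unset Printing Implicit Defensive.

Import Order.TTheory GRing.Theory Num.Theory.
Import numFieldNormedType.Exports.

Local Open Scope classical_set_scope.
Local Open Scope ring_scope.

(** Write [j z] for the inclusion of [z : FV v] in the space of 0-cochains, a
    prime for time derivatives, and [D = delta x].  Since [v] is free, the
    opinion equation at [v] is not projected, and since every incidence of [v]
    adapts, neither are the structure equations at [v]:
      [x_v' = - alpha (delta^T D)_v]   and
      [delta_ve' = - beta D_e x_v^T]  for every [e] incident to [v].
    Testing both against stalk vectors gives
      [<x_v', w> = - alpha <D, delta (j w)>]   and
      [<delta' (j z), delta (j w)> = - beta <x_v, z> <D, delta (j w)>],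
    the second because [delta (j w)] is supported on the edges incident to [v].
    These are [dot_opinion_velocity] and [dot_structure_velocity].  The bilinear
    form of [Q_vv] is
      [<Q_vv z, w> = alpha <delta (j z), delta (j w)> - beta <x_v, z> <x_v, w>],
    and both terms have the derivative
      [- alpha beta (<x_v, z> <D, delta (j w)> + <x_v, w> <D, delta (j z)>)],
    so that their difference has zero derivative on the open half line;
    continuity at [0] and the mean value theorem make it constant.

    For the two limits, let [w] be an eigenvector of [Q_vv(0)] for [a]; then
      [a <w, w> = alpha (\sum_e |F_ve w|^2) - beta <x_v, w>^2]
    at all times.  If [a < 0], the last term stays bounded away from [0], hence
    so does [x_v]; if [a > 0], the sum stays bounded away from [0], hence the
    maps [F_ve] cannot all vanish in the limit.

    Limits and derivatives are given through coordinates, so every quantity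
    above is first written as a polynomial in linear functionals of the curves
    ([cvg_scalar], [is_derive_scalar], [cvg_dot], [is_derive_dot]). *)

(** * Limits and derivatives along curves in a vector space *)

Section Curves.
Variables (R : realType) (W : vectType R).

(** The bridge to coordinates: a functional of [w] is a fixed linear combination
    of the entries of [vcoord w], so it inherits limits and derivatives from
    them. *)
Lemma scalar_vcoord (phi : W -> R) w : scalar phi ->
  phi w = \sum_(i < \dim {:W}) phi (vbasis {:W})`_i * vcoord w 0 i.
Proof.
move=> phil.
pose phiM := GRing.isLinear.Build R W R _ phi phil.
pose phiL : {linear W -> R | *%R} := HB.pack phi phiM.
rewrite -[phi]/(phiL : W -> R) {1}(coord_vbasis (memvf w)) linear_sum.
by apply: eq_bigr => i _; rewrite linearZ mulrC /vcoord /passmx.rVof mxE.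
Qed.

Lemma cvg_scalar (T : Type) (F : set_system T) (FF : Filter F)
    (phi : W -> R) (c : T -> W) l : scalar phi ->
  vcoord (c s) @[s --> F] --> vcoord l -> phi (c s) @[s --> F] --> phi l.
Proof.
move=> phil cl; rewrite (scalar_vcoord l phil).
under eq_fun do rewrite (scalar_vcoord (c _) phil).
apply: (cvg_big add_continuous) => i _; apply: cvgMl_tmp.
exact: (cvg_comp _ _ cl (@coord_continuous _ _ _ 0 i (vcoord l))).
Qed.

Lemma is_derive_scalar (phi : W -> R) (c : R -> W) (t : R) c' : scalar phi ->
  is_derive t 1 (fun s => vcoord (c s)) (vcoord c') ->
  is_derive t 1 (fun s => phi (c s)) (phi c').
Proof.
move=> phil [dc dcE].
have -> : (fun s => phi (c s)) =
    \sum_(i < \dim {:W}) (phi (vbasis {:W})`_i \*: (fun s => vcoord (c s) 0 i)).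
  by apply/funext => s; rewrite fct_sumE (scalar_vcoord _ phil).
rewrite (scalar_vcoord c' phil); apply: is_derive_sum => i.
apply: is_deriveZ; rewrite -dcE (derive_mx dc) mxE.
by apply: derivableP; move/derivable_mxP : dc => /(_ 0 i).
Qed.

End Curves.

Section CurveDot.
Variables (R : realType) (W K : vectType R) (dK : {dot K for idfun}).
Variables (f g : W -> K) (fl : linear f) (gl : linear g).

Let coord_scalar i : scalar (fun w => coord (vbasis {:K}) i (f w)).
Proof. by move=> a x y; rewrite fl linearP. Qed.

Let dot_scalar k : scalar (fun w => dK k (g w)).
Proof. by move=> a x y; rewrite gl dotDr dotZr. Qed.

(* Expanding one argument in a basis leaves products of two functionals. *)
Let dotE x y : dK (f x) (g y) =
  \sum_(i < \dim {:K}) coord (vbasis {:K}) i (f x) * dK (vbasis {:K})`_i (g y).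
Proof.
rewrite {1}(coord_vbasis (memvf (f x))) dot_suml.
by apply: eq_bigr => i _; rewrite dotZl.
Qed.

Lemma cvg_dot (T : Type) (F : set_system T) (FF : Filter F) (c : T -> W) l :
  vcoord (c s) @[s --> F] --> vcoord l ->
  dK (f (c s)) (g (c s)) @[s --> F] --> dK (f l) (g l).
Proof.
move=> cl; rewrite dotE; under eq_fun do rewrite dotE.
apply: (cvg_big add_continuous) => i _; apply: cvgM.
  exact: (cvg_scalar FF (coord_scalar i) cl).
exact: (cvg_scalar FF (dot_scalar _) cl).
Qed.

Lemma is_derive_dot (c : R -> W) (t : R) c' :
  is_derive t 1 (fun s => vcoord (c s)) (vcoord c') ->
  is_derive t 1 (fun s => dK (f (c s)) (g (c s)))
    (dK (f c') (g (c t)) + dK (f (c t)) (g c')).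
Proof.
move=> dc.
have -> : (fun s => dK (f (c s)) (g (c s))) =
    \sum_(i < \dim {:K}) ((fun s => coord (vbasis {:K}) i (f (c s)))
            * (fun s => dK (vbasis {:K})`_i (g (c s)))).
  by apply/funext => s; rewrite fct_sumE dotE.
rewrite !dotE -big_split /=; apply: is_derive_sum => i.
have := is_deriveM (is_derive_scalar (coord_scalar i) dc)
  (is_derive_scalar (dot_scalar _) dc).
move=> h; apply: is_derive_eq; rewrite /= /GRing.scale /=; ring.
Qed.

End CurveDot.

(** * Orthogonal projections, tested against inclusions of stalk vectors *)

Section Projections.
Variables (R : rcfType).

(** Rank one maps turn the Frobenius product into evaluation, which is how
    Frobenius orthogonality gives information on single entries of a map. *)
Lemma frob_rank1 (V W : vectType R) (dV : {dot V for idfun})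
    (dW : {dot W for idfun}) (f : 'Hom(V, W)) w x :
  frob dV dW f (rank1 dV w x) = dW (f x) w.
Proof.
have [s os] := onb_exists dV; have [_ _ sp] := os.
rewrite (frob_onb _ _ _ os) [in RHS](sp x) linear_sum dot_suml.
by apply: eq_bigr => e _; rewrite rank1E dotZr linearZ /= dotZl.
Qed.

Lemma dsum_dot_dinj (I : finType) (E : I -> vectType R)
    (dE : forall i, {dot E i for idfun}) (x : dsum E) i z :
  dsum_dot dE x (dinj E i z) = dE i (x i) z.
Proof.
rewrite /dsum_dot (bigD1 i) //= dinj_in big1 ?addr0 // => j ji.
by rewrite dinj_out 1?eq_sym // linear0r.
Qed.

(** The projection error at [x] is orthogonal to every vector of the subspace,
    and a full factor [T i] contributes all of the vectors [dinj E i z]. *)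
Lemma orthproj_dsum_sub (I : finType) (E : I -> vectType R)
    (dE : forall i, {dot E i for idfun}) (T : forall i, {vspace E i})
    (x : dsum E) i :
  T i = fullv -> orthproj (dsum_dot dE) (dsum_sub T) x i = x i.
Proof.
move=> Ti; have [_ h] := orthprojP (dsum_dot dE) (dsum_sub T) x.
apply/esym/(@dot_inj _ _ (dE i)) => z; rewrite ![dE i z _]dotC.
rewrite -!(dsum_dot_dinj dE); apply/eqP; rewrite -subr_eq0 -dotBl; apply/eqP.
have /h : dinj E i z \in dsum_sub T.
  apply/dsum_subP => j; have [<-|ij] := eqVneq i j; first by rewrite Ti memvf.
  by rewrite dinj_out ?mem0v.
by [].
Qed.

(** The projection error is orthogonal to every supported map, in particular to
    the rank one maps that send [z] in the factor [i] to [b] in the factor [j];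
    by [frob_rank1] its [(i, j)] block therefore vanishes. *)
Lemma block_orthproj_supported (I J : finType) (E : I -> vectType R)
    (F : J -> vectType R) (dE : forall i, {dot E i for idfun})
    (dF : forall j, {dot F j for idfun}) (A : {set I * J})
    (f : 'Hom(dsum E, dsum F)) i j :
  (i, j) \in A ->
  block i j (orthproj (frob (dsum_dot dE) (dsum_dot dF)) (supported_maps E F A) f)
  = block i j f.
Proof.
move=> ijA.
have := orthprojP (frob (dsum_dot dE) (dsum_dot dF)) (supported_maps E F A) f.
move: (orthproj _ _ f) => p [_ h].
apply/lfunP => z; apply/esym/(@dot_inj _ _ (dF j)) => b.
rewrite ![dF j b _]dotC; apply/eqP; rewrite -subr_eq0 -dotBl; apply/eqP.
have : rank1 (dsum_dot dE) (dinj F j b) (dinj E i z) \in supported_maps E F A.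
  apply/supported_mapsP => k l klA; apply/lfunP => a; rewrite zero_lfunE.
  rewrite blockE rank1E dsumZE /= dsum_dot_dinj.
  have [ik|ik] := eqVneq i k; last by rewrite dinj_out // linear0l scale0r.
  have jl : j != l by apply: contraNneq klA => <-; rewrite -ik.
  by rewrite [dinj F j b l]dinj_out ?scaler0.
move/h; rewrite /= frob_rank1 /= dsum_dot_dinj => <-.
by rewrite add_lfunE opp_lfunE -[in RHS]scaleN1r dsumDE dsumZE scaleN1r !blockE.
Qed.

End Projections.

(** * The two velocities at a vertex *)

Section InteriorVertex.
Variables (R : realType) (V : finType) (E : {set {set V}}).
Variables (FV : V -> vectType R) (FE : edge E -> vectType R).
Variables (dV : forall v : V, {dot FV v for idfun}).
Variables (dE : forall e : edge E, {dot FE e for idfun}).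
Local Notation dC0 := (dsum_dot dV).
Local Notation dC1 := (dsum_dot dE).
Local Notation Hom01 := ('Hom(dsum FV, dsum FE)).

Lemma quad_block_laplacian (d : Hom01) v z w :
  dV v (block v v (laplacian dV dE d) z) w = dC1 (d (dinj FV v z)) (d (dinj FV v w)).
Proof.
rewrite blockE -dsum_dot_dinj /laplacian comp_lfunE.
exact: (adjointP dC0 dC1 d).
Qed.

Lemma quad_block_laplacian_restriction (tgt : edge E -> V) (d : Hom01) v w :
  coboundary_like d ->
  dV v (block v v (laplacian dV dE d) w) w =
  \sum_(e : edge E | v \in val e)
    dE e (restriction tgt d v e w) (restriction tgt d v e w).
Proof.
move=> hd; rewrite (laplacian_diagE tgt _ _ _ hd) sum_lfunE dot_suml.
by apply: eq_bigr => e _; rewrite comp_lfunE adjointP.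
Qed.

(** On an edge incident to [v] the projection keeps the block
    [(d x)_e x_v^T]; on any other edge the right factor [d (dinj FV v w)]
    vanishes, so what the projection does there is invisible. *)
Lemma dot_structure_velocity (I : {set V * edge E}) (beta : R) (d : Hom01)
    (x : dsum FV) v (z w : FV v) :
  coboundary_like d -> (forall e : edge E, v \in val e -> (v, e) \in I) ->
  dC1 ((- beta *: orthproj (frob dC0 dC1) (supported_maps FV FE I)
                    (rank1 dC0 (d x) x)) (dinj FV v z)) (d (dinj FV v w))
  = - beta * (dV v (x v) z * dC1 (d x) (d (dinj FV v w))).
Proof.
move=> hd hv; rewrite scale_lfunE dotZl; congr (_ * _).
rewrite /= /dsum_dot mulr_sumr; apply: eq_bigr => e _.
have [ve|ve] := boolP (v \in val e); last first.
  rewrite -[X in dE _ _ X]blockE -[X in _ = _ * dE _ _ X]blockE hd //.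
  by rewrite zero_lfunE !linear0r.
rewrite -[X in dE _ X _]blockE block_orthproj_supported ?hv //.
by rewrite blockE rank1E dsumZE dotZl /= dsum_dot_dinj.
Qed.

Lemma dot_opinion_velocity (T : forall v, {vspace FV v}) (alpha : R)
    (d : Hom01) (x : dsum FV) v (z : FV v) : T v = fullv ->
  dV v ((- alpha *: orthproj dC0 (dsum_sub T) (adjoint dC0 dC1 d (d x))) v) z
  = - alpha * dC1 (d x) (d (dinj FV v z)).
Proof.
move=> Tv.
rewrite dsumZE dotZl orthproj_dsum_sub //; congr (_ * _).
rewrite -dsum_dot_dinj; exact: (adjointP dC0 dC1 d).
Qed.

End InteriorVertex.

(** * Conservation law and its consequences *)

(** A solution started at time [0] is only continuous there, and this is what
    the mean value theorem on [[0, t]] asks of the end point. *)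
Lemma derive0_within_cst (R : realType) (f : R -> R) :
  {within `[0, +oo[, continuous f} -> (forall t : R, 0 < t -> is_derive t 1 f 0) ->
  forall t, 0 <= t -> f t = f 0.
Proof.
move=> fc df t t0; apply/eqP; rewrite -subr_eq0; apply/eqP.
have [||c _ ->] := @MVT_segment R f (fun=> 0) 0 t t0; last by rewrite mul0r.
  by move=> s; rewrite in_itv /= => /andP[/df].
by apply: continuous_subspaceW fc => s; rewrite /= !in_itv /= => /andP[->].
Qed.

Lemma vcoord0 (R : rcfType) (W : vectType R) : vcoord (0 : W) = 0.
Proof. by apply/rowP => i; rewrite !mxE linear0. Qed.

Lemma leigenvalue_exists (K : fieldType) (W : vectType K) (f : 'End(W)) a :
  passmx.leigenvalue f a -> exists2 w, w != 0 & f w = a *: w.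
Proof.
rewrite /passmx.leigenvalue /passmx.leigenspace => h.
exists (vpick (lker (f - a *: \1%VF))); first by rewrite vpick0.
have := memv_pick (lker (f - a *: \1%VF)); rewrite memv_ker.
rewrite add_lfunE opp_lfunE scale_lfunE id_lfunE subr_eq0.
by move/eqP.
Qed.

Theorem proposition5p4 (R : realType)
  (V : finType) (E : {set {set V}})
  (hsimple : simple_graph E) (hconnected : connected_graph E)
  (src tgt : edge E -> V) (horient : orientation src tgt)
  (FV : V -> vectType R) (FE : edge E -> vectType R)
  (dV : forall v : V, {dot FV v for idfun})
  (dE : forall e : edge E, {dot FE e for idfun})
  (U : {set V}) (S : forall v : V, {vspace FV v})
  (hS : forall v : V, v \notin U -> S v = 0%VS)
  (I : {set V * edge E})
  (hI : forall (v : V) (e : edge E), (v, e) \in I -> v \in val e)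
  (alpha beta : R) (halpha : 0 < alpha) (hbeta : 0 < beta)
  (u : dsum FV) (hu : u \in dsum_sub S)
  (y : R -> dsum FV) (delta : R -> 'Hom(dsum FV, dsum FE))
  (hyQ : forall t : R, 0 <= t -> y t \in dsum_sub (fun v => orthov (dV v) (S v)))
  (hdelta : forall t : R, 0 <= t -> coboundary_like (delta t)) :
  let C0Q : {vspace dsum FV} := dsum_sub (fun v => orthov (dV v) (S v)) in
  let dC0 := dsum_dot dV in
  let dC1 := dsum_dot dE in
  let x : R -> dsum FV := fun t => u + y t in
  forall
  (hy_cont : {within `[0, +oo[, continuous (fun t => vcoord (y t))})
  (hd_cont : {within `[0, +oo[, continuous (fun t => vcoord (delta t))})
  (hy_ode : forall t : R, 0 < t ->
     is_derive t 1 (fun s => vcoord (y s))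
       (vcoord (- alpha *: orthproj dC0 C0Q
                  (adjoint dC0 dC1 (delta t) (delta t (x t))))))
  (hd_ode : forall t : R, 0 < t ->
     is_derive t 1 (fun s => vcoord (delta s))
       (vcoord (- beta *: orthproj (frob dC0 dC1) (supported_maps FV FE I)
                  (rank1 dC0 (delta t (x t)) (x t)))))
  (horbit : precompact
     [set vcoord ((y t, delta t) : (dsum FV * 'Hom(dsum FV, dsum FE))%type)
       | t in `[0, +oo[])
  (v : V) (hvF : v \in ~: U)
  (hvFF : forall e : edge E, v \in val e -> val e \subset ~: U)
  (hvI : forall e : edge E, v \in val e -> (v, e) \in I),
  let Q : R -> 'End(FV v) := fun t =>
    alpha *: block v v (laplacian dV dE (delta t))
    - beta *: rank1 (dV v) (x t v) (x t v) in
  [/\ forall t : R, 0 <= t -> Q t = Q 0,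
      (exists2 a : R, a < 0 & passmx.leigenvalue (Q 0) a) ->
        ~ (vcoord (x t v) @[t --> +oo] --> (0 : 'rV[R]_(\dim {:FV v})))%classic
    & (exists2 a : R, 0 < a & passmx.leigenvalue (Q 0) a) ->
        ~ (forall e : edge E, v \in val e ->
             vcoord (restriction tgt (delta t) v e) @[t --> +oo]
                --> (0 : 'rV[R]_(\dim {:'Hom(FV v, FE e)}))) ].
Proof.
move=> C0Q dC0 dC1 x hyc hdc hy hd _ v hvF _ hvI Q.
have Sv : S v = 0%VS by apply: hS; rewrite finset.in_setC in hvF.
have Tv : orthov (dV v) (S v) = fullv by rewrite Sv orthov0.
have xv t : x t v = y t v.
  move/dsum_subP : hu => /(_ v); rewrite Sv memv0 => /eqP uv.
  by rewrite /x dsumDE uv add0r.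
have QE t z w : dV v (Q t z) w =
    alpha * dC1 (delta t (dinj FV v z)) (delta t (dinj FV v w))
    - beta * (dV v (y t v) z * dV v (y t v) w).
  rewrite /Q add_lfunE opp_lfunE !scale_lfunE dotBl !dotZl quad_block_laplacian.
  by rewrite rank1E dotZl xv.
have evl z : linear (fun d : 'Hom(dsum FV, dsum FE) => d (dinj FV v z)).
  by move=> a f g; rewrite add_lfunE scale_lfunE.
have dotl z : scalar (fun w : dsum FV => dV v (w v) z).
  by move=> a p q; rewrite dsumDE dsumZE dotDl dotZl.
have Qcst t : 0 <= t -> Q t = Q 0.
  move=> t0; apply/lfunP => z; apply: (@dot_inj _ _ (dV v)) => w.
  rewrite ![dV v w _]dotC !QE.
  pose q s := alpha * dC1 (delta s (dinj FV v z)) (delta s (dinj FV v w))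
    - beta * (dV v (y s v) z * dV v (y s v) w).
  apply: (@derive0_within_cst _ q) t0 => [s|s s0].
    apply: cvgB; apply: cvgMl_tmp.
      exact: (cvg_dot (evl z) (evl w) _ (hdc s)).
    by apply: cvgM; apply: (cvg_scalar _ (dotl _) (hyc s)).
  have dd := is_derive_dot dC1 (evl z) (evl w) (hd s s0).
  have dz := is_derive_scalar (dotl z) (hy s s0).
  have dw := is_derive_scalar (dotl w) (hy s s0).
  have dq :=
    is_deriveB (is_deriveZ alpha dd) (is_deriveZ beta (is_deriveM dz dw)).
  apply: is_derive_eq.
  (* The velocity identity has the derivative in the left factor; the other half
     of the product rule is brought to this form by symmetry. *)
  rewrite /dC0 /dC1 /= (dot_structure_velocity _ _ _ _ _ _ (hdelta s (ltW s0)) hvI).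
  rewrite [dsum_dot _ (delta s (dinj FV v z)) _]dotC /=.
  rewrite (dot_structure_velocity _ _ _ _ _ _ (hdelta s (ltW s0)) hvI).
  rewrite !dot_opinion_velocity // xv /GRing.scale /=.
  ring.
split=> // -[a a0 /leigenvalue_exists[w w0 Qw]] lim.
  have : beta * (dV v (x t v) w * dV v (x t v) w) @[t --> +oo] --> (0 : R).
    have l0 : vcoord (x t v) @[t --> +oo] --> vcoord (0 : FV v).
      by rewrite vcoord0.
    have wl : scalar (fun z => dV v z w) by move=> b p q; rewrite dotDl dotZl.
    have := cvg_scalar _ wl l0.
    rewrite linear0l => h; rewrite -(mulr0 beta) -[X in beta * X](mulr0 0).
    by apply: cvgMl_tmp; apply: cvgM; exact: h.
  have aw : 0 < - a * dV v w w by rewrite mulr_gt0 ?oppr_gt0 ?dot_gt0.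
  move=> /cvgr_lt/(_ _ aw) smallx.
  (* The Laplacian term is nonnegative, so [a <w, w>] is at least
     [- beta <x_v, w>^2], which is eventually larger than [a <w, w>]. *)
  have [t [/= lt_aw t0]] :=
    filter_ex (filterI smallx (nbhs_pinfty_ge (num_real 0))).
  have := QE t w w; rewrite Qcst // Qw dotZl -!xv => aE.
  have : 0 <= alpha * dC1 (delta t (dinj FV v w)) (delta t (dinj FV v w)).
    by rewrite mulr_ge0 ?dot_ge0 ?ltW.
  by lra.
have : alpha * \sum_(e : edge E | v \in val e)
    dE e (restriction tgt (delta t) v e w) (restriction tgt (delta t) v e w)
    @[t --> +oo] --> (0 : R).
  rewrite -[X in _ --> X](mulr0 alpha); apply: cvgMl_tmp.
  rewrite [X in _ --> X](_ : 0 = \sum_(e : edge E | v \in val e) 0); last first.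
    by rewrite big1.
  apply: (cvg_big add_continuous) => e ve.
  have l0 : vcoord (restriction tgt (delta t) v e) @[t --> +oo]
      --> vcoord (0 : 'Hom(FV v, FE e)) by rewrite vcoord0; exact: lim.
  have wl : linear (fun f : 'Hom(FV v, FE e) => f w).
    by move=> b p q; rewrite add_lfunE scale_lfunE.
  have := @cvg_dot _ _ _ (dE e) _ _ wl wl _ _ _ _ _ l0.
  by rewrite zero_lfunE linear0l; apply.
have aw : 0 < a * dV v w w by rewrite mulr_gt0 ?dot_gt0.
move=> /cvgr_lt/(_ _ aw) smallL.
have [t [/= lt_aw t0]] :=
    filter_ex (filterI smallL (nbhs_pinfty_ge (num_real 0))).
have := QE t w w; rewrite Qcst // Qw dotZl /dC1 -(quad_block_laplacian dV).
rewrite (quad_block_laplacian_restriction dV dE tgt w (hdelta t t0)) => aE.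
have : 0 <= beta * (dV v (y t v) w * dV v (y t v) w).
  by apply: mulr_ge0; [exact: ltW | rewrite -expr2 sqr_ge0].
by lra.
Qed.
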